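(* Let $M$ be a loopless matroid of rank $n$ on the set $\{0,\dots,N\}$. Let $V$ and $W$ be free abelian groups of rank $N+1$ with bases $\{e_0,\dots,e_N\}$ and $\{f_0,\dots,f_N\}$ respectively, regarded as dual groups via these dual bases. Let $\Sigma(M)\subset V\otimes\mathbb{R}$ be the fan built on the lattice of flats of $M$, let $\mathcal{F}_k(\Sigma(M))\subset\wedge^k V$ be its $k$-th tropical homology group, and let $\mathcal{I}^\bullet\subset\wedge^\bullet W$ be the Orlik-Solomon ideal of $M$. Then for every $k\ge 0$, $$\mathcal{F}_k(\Sigma(M))^\perp=\mathcal{I}^k$$ as subgroups of $\wedge^k W$.
   Context: Fan of a matroid: for a nonempty flat $J=\{j_1,\dots,j_m\}$ of $M$ put $e_J:=e_{j_1}+\dots+e_{j_m}\in V$. The fan $\Sigma(M)\subset V_{\mathbb{R}}=V\otimes\mathbb{R}$ is the simplicial fan whose rays are spanned by the vectors $e_J$, for all nonempty flats $J$ (including $J=M$, the whole ground set), and whose $k$-dimensional cones are spanned by $e_{J_1},\dots,e_{J_k}$ for flags $J_1\subsetneq\dots\subsetneq J_k$ of nonempty flats (the empty flag gives the cone $\{0\}$). Tropical homology: for a rational polyhedral fan $\Sigma$ in $L\otimes\mathbb{R}$, where $L$ is a free abelian group of finite rank, and a cone $\sigma\in\Sigma$, let $\langle\sigma\rangle_{\mathbb{Z}}$ be the lattice of integral points (elements of $L$) in the linear span of $\sigma$. Then $\mathcal{F}_k(\Sigma)\subset\wedge^k L$ is the subgroup generated by all $v_1\wedge\dots\wedge v_k$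 such that $v_1,\dots,v_k\in\langle\sigma\rangle_{\mathbb{Z}}$ for some cone $\sigma\in\Sigma$ (so $\mathcal{F}_0(\Sigma)=\mathbb{Z}$). Orlik-Solomon ideal: for an ordered subset $I=\{i_0,\dots,i_k\}$ of $\{0,\dots,N\}$ put $F_I:=f_{i_0}\wedge\dots\wedge f_{i_k}$, and let $\partial:\wedge^\bullet W\to\wedge^{\bullet-1}W$ be the linear map with $\partial F_I=\sum_{s=0}^k(-1)^s f_{i_0}\wedge\dots\hat f_{i_s}\dots\wedge f_{i_k}$ (the hat denotes omission). $\mathcal{I}=\mathcal{I}^\bullet$ is the ideal of the exterior algebra $\wedge^\bullet W$ over $\mathbb{Z}$ generated by all $\partial F_I$ with $I$ a dependent subset of $M$; $\mathcal{I}^k=\mathcal{I}\cap\wedge^k W$. Duality: the pairing of $V$ and $W$ extends to a perfect pairing $\wedge^k W\times\wedge^k V\to\mathbb{Z}$ for which the bases $f_{i_1}\wedge\dots\wedge f_{i_k}$ and $e_{i_1}\wedge\dots\wedge e_{i_k}$ ($i_1<\dots<i_k$) are dual; $\perp$ denotes the annihilator in $\wedge^k W$ with respect to this pairing. *)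

(* Defs.v *)
From HB Require Import structures.
From mathcomp Require Import all_boot all_order all_algebra ring.

Set Implicit Arguments.
Unset Strict Implicit.
Unset Printing Implicit Defensive.

Import Order.TTheory GRing.Theory Num.Theory.
Local Open Scope ring_scope.

Record matroid (T : finType) := Matroid {
  indep : {set T} -> bool;
  indep0 : indep set0;
  indepS : forall A B : {set T}, A \subset B -> indep B -> indep A;
  indep_aug : forall A B : {set T}, indep A -> indep B -> (#|A| < #|B|)%N ->
    exists2 x, x \in B :\: A & indep (x |: A) }.

Section MatroidDefs.
Variables (T : finType) (M : matroid T).

Definition dependent (A : {set T}) : bool := ~~ indep M A.

Definition mrank (A : {set T}) : nat :=
  \max_(I : {set T} | (I \subset A) && indep M I) #|I|.

Definition loopless : bool := [forall x, indep M [set x]].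

Definition flat (F : {set T}) : bool :=
  [forall (x | x \notin F), mrank F < mrank (x |: F)]%N.

End MatroidDefs.

(* An element is the family of its coordinates in the basis of the ordered
   monomials F_I = f_{i_1} /\ ... /\ f_{i_k} (see [ext_basisE]), where
   I = {i_1 < ... < i_k} ranges over the subsets of {0, ..., m-1}. *)
Definition exterior (m : nat) : Type := {ffun {set 'I_m} -> int}.
HB.instance Definition _ m :=
  GRing.Zmodule.copy (exterior m) {ffun {set 'I_m} -> int}.

Definition ext_coord m (x : exterior m) (I : {set 'I_m}) : int :=
  (x : {ffun {set 'I_m} -> int}) I.

(* The number of adjacent transpositions that sort F_A /\ F_B (A, B disjoint). *)
Definition ninv m (A B : {set 'I_m}) : nat :=
  (\sum_(i in A) \sum_(j in B) (j < i))%N.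

Section Exterior.
Variable m : nat.
Implicit Types (x y z : exterior m) (A B C D I J K : {set 'I_m}).

Definition ext_basis I : exterior m := [ffun J : {set 'I_m} => (J == I)%:R].

Definition ext_mul x y : exterior m :=
  [ffun K : {set 'I_m} => \sum_(A : {set 'I_m} | A \subset K)
     (-1) ^+ ninv A (K :\: A) * (ext_coord x A * ext_coord y (K :\: A))].

Lemma ext_mulE x y K : ext_coord (ext_mul x y) K =
  \sum_(A : {set 'I_m} | A \subset K)
     (-1) ^+ ninv A (K :\: A) * (ext_coord x A * ext_coord y (K :\: A)).
Proof. by rewrite /ext_coord ffunE. Qed.

Lemma ext_coordP x y : (forall K, ext_coord x K = ext_coord y K) -> x = y.
Proof. by move=> xy; apply/ffunP. Qed.

Lemma ext_coordD x y K : ext_coord (x + y) K = ext_coord x K + ext_coord y K.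
Proof. by rewrite /ext_coord ffunE. Qed.

Lemma ext_coord0 K : ext_coord (0 : exterior m) K = 0.
Proof. by rewrite /ext_coord ffunE. Qed.

Lemma ext_coordN x K : ext_coord (- x) K = - ext_coord x K.
Proof. by rewrite /ext_coord ffunE. Qed.

Lemma ext_coord_basis I K : ext_coord (ext_basis I) K = (K == I)%:R.
Proof. by rewrite /ext_coord ffunE. Qed.

Lemma ninvUl A B C : [disjoint A & B] ->
  ninv (A :|: B) C = (ninv A C + ninv B C)%N.
Proof.
move=> dAB; rewrite /ninv -bigU //.
by apply: eq_bigl => i; rewrite in_setU.
Qed.

Lemma ninvUr A B C : [disjoint B & C] ->
  ninv A (B :|: C) = (ninv A B + ninv A C)%N.
Proof.
move=> dBC; rewrite /ninv -big_split; apply: eq_bigr => i _ /=.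
by rewrite -bigU //; apply: eq_bigl => j; rewrite in_setU.
Qed.

Lemma ninv0l A : ninv set0 A = 0%N.
Proof. by rewrite /ninv big_set0. Qed.

Lemma ninv0r A : ninv A set0 = 0%N.
Proof. by rewrite /ninv big1 // => i _; rewrite big_set0. Qed.

Lemma ext_mulA : associative ext_mul.
Proof.
move=> x y z; apply: ext_coordP => K; rewrite !ext_mulE.
under [RHS]eq_bigr => D sDK do rewrite ext_mulE mulr_suml mulr_sumr.
rewrite (exchange_big_dep (fun A : {set 'I_m} => A \subset K)) /=; last first.
  by move=> D A sDK sAD; exact: subset_trans sAD sDK.
apply: eq_bigr => A sAK; rewrite ext_mulE mulr_sumr mulr_sumr.
rewrite [RHS](reindex_onto (fun C : {set 'I_m} => C :|: A)%SET
                      (fun D : {set 'I_m} => D :\: A)%SET) /=; last first.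
  move=> D /andP[_ sAD]; rewrite setUC.
  by rewrite -[RHS](setID D A) (setIidPr sAD).
have subE C : (C \subset K :\: A) =
    [&& C :|: A \subset K, A \subset C :|: A & (C :|: A) :\: A == C].
  rewrite subsetD subUset sAK andbT subsetUr /=.
  congr (_ && _); rewrite setDUl setDv setU0.
  by apply/idP/eqP => [|/setDidPl//]; move/setDidPl.
apply: eq_big => [C|C]; rewrite ?subE -?andbA // => /and3P[sCAK _ /eqP eC].
have dCA : [disjoint C & A].
  by apply/setDidPl; move: eC; rewrite setDUl setDv setU0.
have sCK : C \subset K by rewrite (subset_trans _ sCAK) ?subsetUl.
have -> : K :\: (C :|: A) = (K :\: A) :\: C by rewrite setDDl setUC.
have eKA : K :\: A = C :|: (K :\: A) :\: C.
  rewrite -[LHS](setID _ C); congr (_ :|: _); apply/setIidPr.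
  by rewrite subsetD sCK.
have dC : [disjoint C & (K :\: A) :\: C].
  by rewrite disjoint_sym disjoints_subset subsetDr.
have -> : ninv A (K :\: A) = (ninv A C + ninv A ((K :\: A) :\: C))%N.
  by rewrite [X in ninv A X = _]eKA ninvUr.
rewrite eC setUC ninvUl 1?disjoint_sym // !exprD.
ring.
Qed.

Lemma ext_mul1l : left_id (ext_basis set0) ext_mul.
Proof.
move=> x; apply: ext_coordP => K; rewrite ext_mulE (bigD1 set0) ?sub0set //=.
rewrite ext_coord_basis eqxx ninv0l setD0 !mul1r big1 ?addr0 // => A.
by move=> /andP[_ /negPf A0]; rewrite ext_coord_basis A0 mul0r mulr0.
Qed.

Lemma ext_mul1r : right_id (ext_basis set0) ext_mul.
Proof.
move=> x; apply: ext_coordP => K; rewrite ext_mulE (bigD1 K) //=.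
rewrite setDv ext_coord_basis eqxx ninv0r mul1r mulr1 big1 ?addr0 //.
move=> A /andP[sAK /negPf AK]; rewrite ext_coord_basis setD_eq0.
suff -> : (K \subset A) = false by rewrite !mulr0.
by apply: contraFF AK => sKA; rewrite eqEsubset sAK.
Qed.

Lemma ext_mulDl : left_distributive ext_mul +%R.
Proof.
move=> x y z; apply: ext_coordP => K; rewrite ext_coordD !ext_mulE -big_split.
by apply: eq_bigr => A _ /=; rewrite ext_coordD mulrDl mulrDr.
Qed.

Lemma ext_mulDr : right_distributive ext_mul +%R.
Proof.
move=> x y z; apply: ext_coordP => K; rewrite ext_coordD !ext_mulE -big_split.
by apply: eq_bigr => A _ /=; rewrite ext_coordD !mulrDr.
Qed.

Lemma ext_oner_neq0 : ext_basis set0 != 0.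
Proof.
apply/eqP => /(congr1 (fun x => ext_coord x set0)).
by rewrite ext_coord_basis ext_coord0 eqxx.
Qed.

HB.instance Definition _ := GRing.Zmodule_isNzRing.Build (exterior m)
  ext_mulA ext_mul1l ext_mul1r ext_mulDl ext_mulDr ext_oner_neq0.

Lemma ext_basis1 : ext_basis set0 = 1. Proof. by []. Qed.

Lemma ext_coordM x y K : ext_coord (x * y) K =
  \sum_(A : {set 'I_m} | A \subset K)
     (-1) ^+ ninv A (K :\: A) * (ext_coord x A * ext_coord y (K :\: A)).
Proof. exact: ext_mulE. Qed.

Lemma ext_basisM A B : ext_basis A * ext_basis B =
  if [disjoint A & B] then (-1) ^+ ninv A B * ext_basis (A :|: B) else 0.
Proof.
apply: ext_coordP => K; rewrite ext_coordM.
have sgnE j (z : exterior m) : ext_coord ((-1) ^+ j * z) K = (-1) ^+ j * ext_coord z K.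
  by elim: j z => [|j IH] z; rewrite ?mul1r // !exprS -!mulrA !mulN1r ext_coordN IH.
have [sAK|nsAK] := boolP (A \subset K); last first.
  rewrite big1 => [|C sCK]; last first.
    rewrite ext_coord_basis; case: eqP => [CA|]; last by rewrite mul0r mulr0.
    by rewrite -CA sCK in nsAK.
  case: ifP => _; rewrite ?ext_coord0 // sgnE ext_coord_basis.
  case: eqP => [KAB|]; last by rewrite mulr0.
  by rewrite KAB subsetUl in nsAK.
rewrite (bigD1 A) //= big1 ?addr0 => [|C /andP[_ /negPf CA]]; last first.
  by rewrite ext_coord_basis CA mul0r mulr0.
rewrite !ext_coord_basis eqxx mul1r.
have [dAB|ndAB] := ifP; last first.
  rewrite ext_coord0; case: eqP => [KAB|]; last by rewrite mulr0.
  by rewrite -KAB disjoint_sym disjoints_subset subsetDr in ndAB.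
rewrite sgnE ext_coord_basis.
have -> : (K :\: A == B) = (K == A :|: B).
  apply/eqP/eqP => [<-|->].
    by rewrite -[LHS](setID K A) (setIidPr sAK).
  by rewrite setDUl setDv set0U; apply/setDidPl; rewrite disjoint_sym.
by case: eqP => [->|]; rewrite ?mulr0 // setDUl setDv set0U
  (setDidPl _) // disjoint_sym.
Qed.

Definition ext_gen (i : 'I_m) : exterior m := ext_basis [set i].

Lemma ext_gen_sqr i : ext_gen i * ext_gen i = 0.
Proof. by rewrite ext_basisM disjoints1 in_set1 eqxx. Qed.

Lemma ext_gen_anticomm i j : ext_gen i * ext_gen j = - (ext_gen j * ext_gen i).
Proof.
have [->|ij] := eqVneq i j; first by rewrite ext_gen_sqr oppr0.
rewrite !ext_basisM !disjoints1 !in_set1 [j == i]eq_sym ij /ninv !big_set1 setUC.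
case: (ltngtP i j) => [||/val_inj e]; rewrite ?expr0 ?expr1 ?mulN1r ?mul1r ?opprK //.
by rewrite e eqxx in ij.
Qed.

Lemma ext_basisE I : ext_basis I = \prod_(i <- enum I) ext_gen i.
Proof.
have : sorted ltn (map val (enum I)).
  rewrite -[enum I](eq_filter (mem_enum _)).
  rewrite -(eq_filter (mem_map val_inj _)) -filter_map.
  by rewrite (sorted_filter ltn_trans) // unlock val_ord_enum iota_ltn_sorted.
rewrite -[in ext_basis I](set_enum I).
elim: (enum I) => [|i s IH] /=.
  by rewrite big_nil => _; rewrite -ext_basis1; congr ext_basis; apply/setP=>?; rewrite !inE.
rewrite (path_sortedE ltn_trans) => /andP[/allP lt_is /IH]; rewrite big_cons => <-.
rewrite ext_basisM disjoints1 !inE.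
have /negPf -> : i \notin s.
  by apply/negP => /(map_f val)/lt_is; rewrite ltnn.
rewrite /ninv big_set1 big1 ?mul1r => [|j]; last first.
  by rewrite !inE => /(map_f val)/lt_is /= /ltnW; rewrite leqNgt => /negPf ->.
by congr ext_basis; apply/setP=> j; rewrite !inE.
Qed.

End Exterior.

From mathcomp Require Import boolp classical_sets reals.
Local Open Scope classical_set_scope.

(* The image in Lambda^1 of a vector of Z^m. *)
Definition ext_vec m (v : 'rV[int]_m) : exterior m :=
  \sum_(i < m) ext_gen i *~ v 0 i.

Definition ext_degree m (k : nat) : set (exterior m) :=
  [set x | forall I : {set 'I_m}, ext_coord x I != 0 -> #|I| = k].

Definition subgroup_generated (U : zmodType) : set U -> set U :=
  smallest (fun A => GRing.zmod_closed (mem A)).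

Definition ideal_generated (S : nzRingType) : set S -> set S :=
  smallest (fun A => GRing.zmod_closed (mem A) /\
                     forall a x, A x -> A (a * x) /\ A (x * a)).

(* The free group W with basis f_0, ..., f_N and its dual V with basis
   e_0, ..., e_N are both coordinatised by Z^(N+1), so that [exterior N.+1]
   stands for either exterior algebra and [ext_basis I] for F_I as well as for
   the dual monomial E_I; the two families are dual bases for [ext_pairing]. *)
Definition ext_pairing m (w v : exterior m) : int :=
  \sum_(I : {set 'I_m}) ext_coord w I * ext_coord v I.

Lemma ext_pairing_basis m (I J : {set 'I_m}) :
  ext_pairing (ext_basis I) (ext_basis J) = (I == J)%:R.
Proof.
rewrite /ext_pairing (bigD1 I) //= big1 => [|K /negPf KI].
  by rewrite !ext_coord_basis eqxx mul1r addr0.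
by rewrite ext_coord_basis KI mul0r.
Qed.

Definition ext_perp m (k : nat) (S : set (exterior m)) : set (exterior m) :=
  [set w | ext_degree k w /\ forall v, S v -> ext_pairing w v = 0].

Section Tropical.
Variables (R : realType) (m : nat).

Definition real_vec (v : 'rV[int]_m) : 'rV[R]_m := map_mx intr v.

Definition cone (s : seq 'rV[R]_m) : set 'rV[R]_m :=
  [set x | exists2 c : 'I_(size s) -> R, (forall i, 0 <= c i)
                                       & x = \sum_i c i *: s`_i].

Definition linear_span : set 'rV[R]_m -> set 'rV[R]_m :=
  smallest (fun A => GRing.submod_closed (mem A)).

Definition lattice_span (sigma : set 'rV[R]_m) : set 'rV[int]_m :=
  [set v | linear_span sigma (real_vec v)].

(* A fan is given by the set of its cones. *)
Definition tropical_homology (k : nat) (Sigma : set (set 'rV[R]_m)) :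
    set (exterior m) :=
  subgroup_generated
    [set x | exists2 sigma, Sigma sigma &
       exists2 v : 'I_k -> 'rV[int]_m, (forall i, lattice_span sigma (v i))
                                     & x = \prod_(i < k) ext_vec (v i)].

Definition flat_vec (J : {set 'I_m}) : 'rV[int]_m :=
  \sum_(j in J) delta_mx 0 j.

Definition flag (M : matroid 'I_m) (s : seq {set 'I_m}) : bool :=
  sorted (fun A B : {set 'I_m} => A \proper B) s &&
  all (fun J => (J != finset.set0) && flat M J) s.

Definition matroid_fan (M : matroid 'I_m) : set (set 'rV[R]_m) :=
  [set cone [seq real_vec (flat_vec J) | J <- s] | s in [set s | flag M s]].

End Tropical.

Arguments matroid_fan R {m} M _ : rename.

(* [enum_val s] is the s-th element of I in increasing order. *)
Definition boundary_basis m (I : {set 'I_m}) : exterior m :=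
  \sum_(s < #|I|) (-1) ^+ s * ext_basis (I :\ enum_val s)%SET.

Definition boundary m (x : exterior m) : exterior m :=
  \sum_(I : {set 'I_m}) boundary_basis I *~ ext_coord x I.

Lemma boundary_basisE m (I : {set 'I_m}) : boundary (ext_basis I) = boundary_basis I.
Proof.
rewrite /boundary (bigD1 I) //= ext_coord_basis eqxx mulr1z big1 ?addr0 // => J.
by move=> /negPf JI; rewrite ext_coord_basis JI mulr0z.
Qed.

Lemma boundaryD m : {morph @boundary m : x y / x + y}.
Proof.
move=> x y; rewrite /boundary -big_split; apply: eq_bigr => I _ /=.
by rewrite ext_coordD mulrzDr.
Qed.

Definition orlik_solomon_ideal m (M : matroid 'I_m) : set (exterior m) :=
  ideal_generated [set boundary (ext_basis I) | I in [set I | dependent M I]].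

(* Main.v *)
Require Import Defs.
From HB Require Import structures.
From mathcomp Require Import boolp classical_sets reals.
From mathcomp Require Import all_boot all_order all_algebra ring.

Set Implicit Arguments.
Unset Strict Implicit.
Unset Printing Implicit Defensive.

Import GRing.Theory Num.Theory.
Local Open Scope ring_scope.

(** The proof compares both sides with the monomials F_B attached to the
independent sets B without broken circuits.

The tool is the contraction i_a, the adjoint of left multiplication by f_a.  It
is an antiderivation, and the boundary is the sum of all the contractions;
hence boundary (f_a x) = x - f_a (boundary x).

The ideal annihilates the tropical homology ([os_ideal_pairing0]).  Fix a flag
of flats and call a and b inseparable if every member of the flag contains both
or neither.  A lattice vector in the span of the cone of the flag has equal
coordinates at a and b, so contracting a product v of such vectors by f_a or by
f_b gives the same result; equivalently, v annihilates the ideal generated by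
f_a - f_b.  A dependent set S contains two inseparable elements a and b
([flag_separated_indep]), and writing F_S as a multiple of f_a f_b y one gets

  boundary (f_a f_b y) = (f_b - f_a) (y - f_b (boundary y)),

which lies in that ideal.

Conversely, let w of degree k annihilate the tropical homology.  If A is
dependent or contains a broken circuit, the boundary of a dependent set rewrites
F_A, modulo the Orlik-Solomon ideal, as a combination of monomials of the same
degree whose index sets have a smaller sum of elements
([nbc_reducible_basis]).  So w is congruent to a combination y of monomials F_B,
B independent without broken circuits, and y still annihilates the tropical
homology by the first part.  For such a
B = {b_1 < ... < b_k} the closures J_i of {b_i, ..., b_k} form a flag of flats
and J_i has minimum b_i.  Hence the product of the e_{J_i} is F_B plus monomials
of larger sum ([prod_vec_leading]).  If y were nonzero and B had maximal sum
among the monomials occurring in y, the pairing of that product with y would be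
the nonzero coefficient of F_B in y ([nbc_supported_eq0]). *)

Lemma mulr_signCA (S : pzRingType) p (x y : S) :
  x * ((-1) ^+ p * y) = (-1) ^+ p * (x * y).
Proof. by rewrite mulrA commr_sign mulrA. Qed.

(** * Contractions of the exterior algebra *)

Section ExteriorAlgebra.
Variable m : nat.
Implicit Types (x y z w v : exterior m) (A B I J K : {set 'I_m}) (i j : 'I_m).

Lemma ext_coord_sum (T : Type) (r : seq T) (P : pred T) (F : T -> exterior m) K :
  ext_coord (\sum_(t <- r | P t) F t) K = \sum_(t <- r | P t) ext_coord (F t) K.
Proof.
apply: (big_morph (fun x => ext_coord x K)) => [x y|]; first exact: ext_coordD.
exact: ext_coord0.
Qed.

Lemma ext_coordMz x (n : int) K : ext_coord (x *~ n) K = ext_coord x K *~ n.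
Proof.
have natE p : ext_coord (x *+ p) K = ext_coord x K *+ p.
  by elim: p => [|p IH]; rewrite ?mulr0n ?ext_coord0 // !mulrS ext_coordD IH.
by case: n => p; rewrite ?NegzE ?mulrNz -?pmulrn ?ext_coordN natE.
Qed.

Lemma ext_coord_sign p x K : ext_coord ((-1) ^+ p * x) K = (-1) ^+ p * ext_coord x K.
Proof.
by elim: p x => [|p IH] x; rewrite ?mul1r // !exprS -!mulrA !mulN1r ext_coordN IH.
Qed.

Lemma ext_sum_basis x : x = \sum_I ext_basis I *~ ext_coord x I.
Proof.
apply: ext_coordP => K; rewrite ext_coord_sum (bigD1 K) //= ext_coordMz.
rewrite ext_coord_basis eqxx big1 ?addr0 ?intz // => I /negPf IK.
by rewrite ext_coordMz ext_coord_basis eq_sym IK mul0rz.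
Qed.

(** For properties stable under left multiplication this avoids any reference to
monomials and signs. *)
Lemma ext_ind (P : exterior m -> Prop) :
  P 0 -> (forall x y, P x -> P y -> P (x + y)) -> (forall x, P x -> P (- x)) ->
  P 1 -> (forall i x, P x -> P (ext_gen i * x)) -> forall x, P x.
Proof.
move=> P0 PD PN P1 PM x; rewrite [x]ext_sum_basis; apply: big_ind => // I _.
have PI : P (ext_basis I).
  rewrite ext_basisE; elim: (enum I) => [|i s IH]; first by rewrite big_nil.
  by rewrite big_cons; apply: PM.
have Pn p : P (ext_basis I *+ p).
  by elim: p => [|p IH]; rewrite ?mulr0n // mulrS; apply: PD.
case: (ext_coord x I) => p; first exact: Pn.
by rewrite NegzE mulrNz -pmulrn; apply/PN/Pn.
Qed.

Lemma ext_coord_genM i x K : ext_coord (ext_gen i * x) K =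
  if i \in K then (-1) ^+ ninv [set i] (K :\ i) * ext_coord x (K :\ i) else 0.
Proof.
rewrite ext_coordM; have [iK|niK] := ifP.
  rewrite (bigD1 [set i]) ?sub1set //= ext_coord_basis eqxx mul1r big1 ?addr0 //.
  by move=> A /andP[_ /negPf nA]; rewrite ext_coord_basis nA mul0r mulr0.
rewrite big1 // => A sAK; rewrite ext_coord_basis.
by case: eqP sAK => [->|]; rewrite ?sub1set ?niK // mul0r mulr0.
Qed.

(** The sign is that of moving f_i to the front of F_(i |: K), so that [contraction i]
is the interior product with the i-th basis vector. *)
Definition contraction i x : exterior m :=
  [ffun K : {set 'I_m} =>
     if i \in K then 0 else (-1) ^+ ninv [set i] K * ext_coord x (i |: K)].

Lemma contractionE i x K : ext_coord (contraction i x) K =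
  if i \in K then 0 else (-1) ^+ ninv [set i] K * ext_coord x (i |: K).
Proof. by rewrite /ext_coord ffunE. Qed.

Lemma contraction_is_additive i : zmod_morphism (contraction i).
Proof.
move=> x y; apply: ext_coordP => K.
rewrite ext_coordD ext_coordN !contractionE.
by case: ifP => _; rewrite ?subr0 // ext_coordD ext_coordN mulrBr.
Qed.

HB.instance Definition _ i := GRing.isZmodMorphism.Build (exterior m) (exterior m)
  (contraction i) (contraction_is_additive i).

Lemma contraction1 i : contraction i 1 = 0.
Proof.
apply: ext_coordP => K; rewrite contractionE ext_coord0 -ext_basis1 ext_coord_basis.
case: ifP => // _; case: eqP => [/setP/(_ i)|_]; last by rewrite mulr0.
by rewrite !inE eqxx.
Qed.

Lemma ninv1U i j K : j \notin K -> ninv [set i] (j |: K) = ((j < i)%N + ninv [set i] K)%N.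
Proof. by move=> jK; rewrite /ninv !big_set1 big_setU1. Qed.

(** The antiderivation rule.  On a monomial F_K with i = j one of the two products
vanishes, according to whether j is in K, and the other gives back F_K.  With
i <> j, inserting f_j and removing f_i in either order differ by one
transposition, whence the minus sign. *)
Lemma contraction_genM i j x :
  contraction i (ext_gen j * x) = x *+ (i == j) - ext_gen j * contraction i x.
Proof.
apply: ext_coordP => K.
rewrite ext_coordD ext_coordN contractionE !ext_coord_genM contractionE.
have [->|ij] := eqVneq i j.
  have [jK|njK] := boolP (j \in K); rewrite !inE eqxx ?andbF /=.
    by rewrite setD1K // mulrA -expr2 sqrr_sign mul1r subrr.
  by rewrite setU1K // mulrA -expr2 sqrr_sign mul1r subr0.
rewrite !inE ext_coord0 sub0r eq_sym (negPf ij) /=.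
have [iK|niK] := boolP (i \in K); first by case: ifP; rewrite ?mulr0 ?oppr0.
have [jK|njK] := boolP (j \in K); last by rewrite mulr0 oppr0.
have -> : (i |: K) :\ j = i |: K :\ j.
  by apply/setP=> l; rewrite !inE; case: eqVneq => // ->; rewrite eq_sym (negPf ij).
have niKj : i \notin K :\ j by rewrite !inE (negPf niK) andbF.
rewrite -{1}(setD1K jK) !ninv1U //; last by rewrite !inE eqxx.
rewrite !mulrA -mulNr; congr (_ * _); rewrite !exprD.
(* Exactly one of i < j and j < i holds, which accounts for the sign. *)
case: (ltngtP i j) => [||/val_inj e]; rewrite ?expr0 ?expr1; try by move=> *; ring.
by rewrite e eqxx in ij.
Qed.

Lemma ext_pairingC w v : ext_pairing w v = ext_pairing v w.
Proof. by apply: eq_bigr => I _; rewrite mulrC. Qed.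

Lemma ext_pairingDl x y v : ext_pairing (x + y) v = ext_pairing x v + ext_pairing y v.
Proof. by rewrite -big_split; apply: eq_bigr => I _ /=; rewrite ext_coordD mulrDl. Qed.

Lemma ext_pairingNl x v : ext_pairing (- x) v = - ext_pairing x v.
Proof. by rewrite -sumrN; apply: eq_bigr => I _ /=; rewrite ext_coordN mulNr. Qed.

Lemma ext_pairing0l v : ext_pairing 0 v = 0.
Proof. by rewrite /ext_pairing big1 // => I _; rewrite ext_coord0 mul0r. Qed.

Lemma ext_pairingBl x y v : ext_pairing (x - y) v = ext_pairing x v - ext_pairing y v.
Proof. by rewrite ext_pairingDl ext_pairingNl. Qed.

Lemma ext_pairing_basisl K v : ext_pairing (ext_basis K) v = ext_coord v K.
Proof.
rewrite /ext_pairing (bigD1 K) //= ext_coord_basis eqxx mul1r big1 ?addr0 // => I.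
by move=> /negPf IK; rewrite ext_coord_basis IK mul0r.
Qed.

(** Contraction is defined so that this adjunction holds; it turns statements on
multiples of an element into statements on what they are paired with. *)
Lemma ext_pairing_genM i w v :
  ext_pairing (ext_gen i * w) v = ext_pairing w (contraction i v).
Proof.
rewrite /ext_pairing (bigID (fun K : {set 'I_m} => i \in K)) /= addrC.
rewrite big1 ?add0r; last by move=> K /negPf iK; rewrite ext_coord_genM iK mul0r.
rewrite [RHS](bigID (fun K : {set 'I_m} => i \in K)) /=.
rewrite [X in _ = X + _]big1 ?add0r; last first.
  by move=> K iK; rewrite contractionE iK mulr0.
rewrite (reindex_onto (fun K => i |: K) (fun K => K :\ i)) /=; last first.
  by move=> K iK; rewrite setD1K.
apply: eq_big => K.
  rewrite !inE eqxx; apply/eqP/idP => [<-|/setU1K //]; by rewrite !inE eqxx.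
move=> /andP[_ /eqP eK]; rewrite ext_coord_genM !inE eqxx /= eK contractionE.
have /negPf -> : i \notin K by rewrite -eK !inE eqxx.
by ring.
Qed.

(** The adjoint of the anticommutation of f_i and f_j. *)
Lemma contraction_anticomm i j x :
  contraction i (contraction j x) = - contraction j (contraction i x).
Proof.
apply: ext_coordP => K; rewrite ext_coordN -!ext_pairing_basisl -!ext_pairing_genM.
by rewrite !mulrA ext_gen_anticomm mulNr ext_pairingNl.
Qed.

Lemma boundary_is_additive : zmod_morphism (@boundary m).
Proof.
have b0 : boundary (0 : exterior m) = 0.
  by rewrite /boundary big1 // => I _; rewrite ext_coord0 mulr0z.
move=> x y; rewrite boundaryD; congr (_ + _); apply/eqP.
by rewrite -addr_eq0 -boundaryD addNr b0.
Qed.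

HB.instance Definition _ := GRing.isZmodMorphism.Build (exterior m) (exterior m)
  (@boundary m) boundary_is_additive.

Lemma boundary_sign p x : boundary ((-1) ^+ p * x) = (-1) ^+ p * boundary x.
Proof. by rewrite -signr_odd; case: odd; rewrite ?mulN1r ?raddfN ?mul1r. Qed.

Lemma sorted_enum_ord I : sorted ltn [seq val i | i <- enum I].
Proof.
rewrite sorted_map {1}/enum_mem -enumT; apply: sorted_filter.
  by move=> j i k; apply: ltn_trans.
by rewrite -sorted_map val_enum_ord iota_ltn_sorted.
Qed.

Lemma ltn_enum_val I (s t : 'I_#|I|) : (enum_val s < enum_val t)%N = (s < t)%N.
Proof.
have nthE (u : 'I_#|I|) : val (enum_val u) = nth 0%N (map val (enum I)) u.
  by rewrite (nth_map (enum_val u)) -?cardE // -(enum_val_nth (enum_val u)).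
have lt_mono (u u' : 'I_#|I|) : (u < u')%N -> (enum_val u < enum_val u')%N.
  move=> uu'; rewrite !nthE (sorted_ltn_nth ltn_trans) ?sorted_enum_ord //.
    by rewrite inE size_map -cardE.
  by rewrite inE size_map -cardE.
case: (ltngtP s t) => [/lt_mono //|/lt_mono|/val_inj ->]; last by rewrite ltnn.
by move/ltnW; rewrite leqNgt => /negPf.
Qed.

(** The exponent s in the definition of the boundary counts the elements of I below
the s-th one, which is also the exponent in the contraction by that element. *)
Lemma ninv_enum_val I (s : 'I_#|I|) : ninv [set enum_val s] (I :\ enum_val s) = s.
Proof.
have -> : ninv [set enum_val s] (I :\ enum_val s) = ninv [set enum_val s] I.
  by rewrite -[X in _ = ninv _ X](setD1K (enum_valP s)) ninv1U ?ltnn // !inE eqxx.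
rewrite /ninv big_set1 big_enum_val /=; under eq_bigr do rewrite ltn_enum_val.
rewrite -[RHS]card_ord -[RHS]sum1_card.
rewrite [RHS](big_ord_widen _ (fun=> 1%N) (ltnW (ltn_ord s))).
by rewrite [RHS]big_mkcond; apply: eq_bigr => t _; case: (t < s)%N.
Qed.

Lemma contraction_basis i I : contraction i (ext_basis I) =
  if i \in I then (-1) ^+ ninv [set i] (I :\ i) * ext_basis (I :\ i) else 0.
Proof.
have [iI|niI] := ifP; last first.
  apply: ext_coordP => K; rewrite contractionE ext_coord0 ext_coord_basis.
  case: ifP => // _; case: eqP => [e|_]; last by rewrite mulr0.
  by rewrite -e !inE eqxx in niI.
apply: ext_coordP => K; rewrite contractionE ext_coord_sign !ext_coord_basis.
have [iK|niK] := boolP (i \in K).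
  case: eqP => [e|_]; last by rewrite mulr0.
  by rewrite e !inE eqxx in iK.
have -> : (i |: K == I) = (K == I :\ i).
  by apply/eqP/eqP => [<-|->]; rewrite ?setU1K ?setD1K.
by case: eqP => [->|]; rewrite ?mulr0.
Qed.

(** The boundary is the interior product with the sum of all basis vectors; it
inherits the antiderivation rule from the contractions. *)
Lemma boundary_sum_contraction x : boundary x = \sum_i contraction i x.
Proof.
rewrite [in RHS](ext_sum_basis x) /boundary.
under [RHS]eq_bigr do rewrite raddf_sum.
rewrite exchange_big; apply: eq_bigr => I _ /=.
under [RHS]eq_bigr do rewrite raddfMz /= contraction_basis.
rewrite -mulrz_suml (bigID (mem I)) /= [X in _ + X]big1 ?addr0; last first.
  by move=> i /negPf ->.
congr (_ *~ _); rewrite big_enum_val /=; apply: eq_bigr => s _.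
by rewrite enum_valP ninv_enum_val.
Qed.

Lemma boundary_genM j x : boundary (ext_gen j * x) = x - ext_gen j * boundary x.
Proof.
rewrite !boundary_sum_contraction mulr_sumr.
under eq_bigr do rewrite contraction_genM.
rewrite sumrB (bigD1 j) //= eqxx mulr1n big1 ?addr0 // => i /negPf ij.
by rewrite ij.
Qed.

Lemma ext_vecM (u : 'rV[int]_m) x : ext_vec u * x = \sum_i (ext_gen i * x) *~ u 0 i.
Proof. by rewrite /ext_vec mulr_suml; apply: eq_bigr => i _; rewrite mulrzAl. Qed.

Lemma contraction_vecM i (u : 'rV[int]_m) x :
  contraction i (ext_vec u * x) = x *~ u 0 i - ext_vec u * contraction i x.
Proof.
rewrite !ext_vecM raddf_sum.
under eq_bigr do rewrite raddfMz /= contraction_genM mulrzBl.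
rewrite sumrB (bigD1 i) //= eqxx mulr1n big1 ?addr0 // => j.
by rewrite eq_sym => /negPf ->; rewrite mulr0n mul0rz.
Qed.

(** The monomials are ordered by the sum of their indices: exchanging an index for a
smaller one lowers it, and a componentwise larger index set has a larger sum. *)
Definition weight K : nat := (\sum_(i in K) i)%N.

Definition weight_ge d x := forall K, ext_coord x K != 0 -> (d <= weight K)%N.

Lemma weight_geD d x y : weight_ge d x -> weight_ge d y -> weight_ge d (x + y).
Proof.
move=> xd yd K; rewrite ext_coordD; case: (eqVneq (ext_coord x K) 0) => [->|/xd //].
by rewrite add0r => /yd.
Qed.

Lemma weight_ge0 d : weight_ge d 0.
Proof. by move=> K; rewrite ext_coord0 eqxx. Qed.

Lemma weight_geMz d x n : weight_ge d x -> weight_ge d (x *~ n).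
Proof.
move=> xd K; rewrite ext_coordMz; have [->|/xd //] := eqVneq (ext_coord x K) 0.
by rewrite mul0rz eqxx.
Qed.

Lemma weight_ge_genM d d' i x :
  (d' <= i + d)%N -> weight_ge d x -> weight_ge d' (ext_gen i * x).
Proof.
move=> le_d xd K; rewrite ext_coord_genM; case: ifP => [iK|]; last by rewrite eqxx.
rewrite mulf_eq0 signr_eq0 /= => /xd; rewrite /weight (big_setD1 i iK) /= => ?.
by apply: leq_trans le_d _; rewrite leq_add2l.
Qed.

(** If u b starts with the coefficient 1 at b, then expanding the product of the u b
replaces the indices b by larger ones, so the product of the f_b is its leading
term. *)
Lemma prod_vec_leading (l : seq 'I_m) (u : 'I_m -> 'rV[int]_m) :
  (forall b, b \in l -> u b 0 b = 1) ->
  (forall b c, b \in l -> u b 0 c != 0 -> (b <= c)%N) ->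
  weight_ge (\sum_(b <- l) b)%N (\prod_(b <- l) ext_gen b) /\
  weight_ge (\sum_(b <- l) b).+1
    (\prod_(b <- l) ext_vec (u b) - \prod_(b <- l) ext_gen b).
Proof.
elim: l => [|b l IH] u1 ule.
  by rewrite !big_nil subrr; split; [move=> K _|exact: weight_ge0].
have sub_l b' : b' \in l -> b' \in b :: l by rewrite inE => ->; rewrite orbT.
have {IH}[b' /sub_l/u1 //|b' c /sub_l b'l|IHy IHxy] := IH; first exact: ule.
rewrite !big_cons; set y := \prod_(_ <- _) ext_gen _ in IHy IHxy *.
set x := \prod_(_ <- _) _ in IHxy *.
split; first exact: weight_ge_genM IHy.
have IHx : weight_ge (\sum_(b <- l) b)%N x.
  rewrite -[x](subrK y); apply: weight_geD => // K /IHxy; exact: ltnW.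
(* The terms c > b of the new vector u b already raise the weight of all of x. *)
have -> : ext_vec (u b) * x - ext_gen b * y =
    \sum_(c | c != b) (ext_gen c * x) *~ u b 0 c + ext_gen b * (x - y).
  by rewrite ext_vecM (bigD1 b) //= u1 ?mem_head // mulr1z mulrBr addrA [in LHS]addrC.
apply: weight_geD; last by apply: weight_ge_genM IHxy; rewrite addnS.
apply: big_ind => [||c cb]; [exact: weight_ge0|exact: weight_geD|].
have [->|/ule] := eqVneq (u b 0 c) 0; first by rewrite mulr0z; exact: weight_ge0.
rewrite mem_head => /(_ isT) le_bc; apply/weight_geMz/weight_ge_genM/IHx.
by rewrite -addSn leq_add2r ltn_neqAle le_bc andbT eq_sym.
Qed.

End ExteriorAlgebra.

(** * Flats of a matroid *)

Section Matroid.
Variables (T : finType) (M : matroid T).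
Implicit Types (A B F I J S : {set T}) (a b x : T).

Lemma indep_card_mrank I A : I \subset A -> indep M I -> (#|I| <= mrank M A)%N.
Proof.
by move=> IA iI; apply: (@leq_bigmax_cond _ _ (fun J : {set T} => #|J|)); rewrite IA.
Qed.

Lemma mrank_indep A : exists I, [/\ I \subset A, indep M I & #|I| = mrank M A].
Proof.
have [|I /andP[IA iI] eI] :=
  @eq_bigmax_cond _ [pred I : {set T} | (I \subset A) && indep M I] (fun I => #|I|).
  by apply/card_gt0P; exists finset.set0; rewrite inE sub0set indep0.
by exists I; split.
Qed.

(** Extend A to a basis B of F.  As F is a flat, a |: F has larger rank than F, so B
can be augmented inside a |: F; the added element is not in F, so it is a. *)
Lemma flat_indepU1 F A a :
  flat M F -> A \subset F -> indep M A -> a \notin F -> indep M (a |: A).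
Proof.
move=> /forall_inP flF AF iA aF.
pose P (C : {set T}) := [&& A \subset C, C \subset F & indep M C].
have [B /and3P[AB BF iB] maxB] :
    exists2 B, P B & forall C, P C -> (#|C| <= #|B|)%N.
  have PA : P A by rewrite /P subxx AF.
  by case: (@arg_maxnP _ A P (fun C => #|C|) PA) => B PB maxB; exists B.
have [I [sI iI cI]] := mrank_indep (a |: F).
have [|x] := indep_aug iB iI.
  by rewrite cI; apply: leq_ltn_trans (flF a aF); apply: indep_card_mrank.
rewrite inE => /andP[xB xI] ixB.
have [xF|xF] := boolP (x \in F).
  have := maxB (x |: B).
  rewrite /P ixB (subset_trans AB) ?subsetUr // subUset sub1set xF BF cardsU1 xB.
  by rewrite ltnn => /(_ isT).
have : x \in a |: F by apply: (subsetP sI).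
rewrite !inE (negPf xF) orbF => /eqP ex.
by apply: indepS ixB; rewrite ex setUS.
Qed.

(** Induction on the flag.  If J is its largest member, the smaller members separate
the elements of S in J, which are thus independent, whereas no member separates
two elements outside J, so at most one element of S lies outside J.  With no
member left S has at most one element, and is independent because M has no
loops. *)
Lemma flag_separated_indep (s : seq {set T}) S : loopless M ->
  sorted (fun A B => A \proper B) s -> all (flat M) s ->
  {in S &, forall a b, (forall J, J \in s -> (a \in J) = (b \in J)) -> a = b} ->
  indep M S.
Proof.
move=> /forallP nl; elim/last_ind: s S => [|s J IH] S.
  move=> _ _ sepS; have [->|[a aS]] := set_0Vmem S; first exact: indep0.
  by apply: indepS (nl a); apply/subsetP => b bS; rewrite inE (sepS b a).
have ptr : transitive (fun A B : {set T} => A \proper B).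
  by move=> B A C; apply: proper_trans.
rewrite (sorted_pairwise ptr) pairwise_rcons -(sorted_pairwise ptr) all_rcons.
move=> /andP[/allP sJ srt] /andP[flJ fls] sepS.
have iSJ : indep M (S :&: J).
  apply: IH => // a b; rewrite !inE => /andP[aS aJ] /andP[bS bJ] ab; apply: sepS => // K.
  by rewrite mem_rcons inE => /predU1P[->|/ab //]; rewrite aJ bJ.
have [eS|[a]] := set_0Vmem (S :\: J).
  by apply: indepS iSJ; rewrite subsetI subxx -setD_eq0 eS eqxx.
rewrite inE => /andP[aJ aS].
apply: indepS (flat_indepU1 flJ (subsetIr S J) iSJ aJ).
apply/subsetP => b bS; rewrite !inE bS.
have [|bJ] := boolP (b \in J); first by rewrite orbT.
rewrite orbF; apply/eqP/sepS => // K; rewrite mem_rcons inE => /predU1P[->|Ks].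
  by rewrite (negPf aJ) (negPf bJ).
have /subsetP KJ := proper_sub (sJ K Ks).
by rewrite (contraNF (KJ a) aJ) (contraNF (KJ b) bJ).
Qed.

(** For independent A this is the matroid closure of A; in this form membership is
read off from independence, without computing ranks. *)
Definition indep_closure A := [set x | (x \in A) || dependent M (x |: A)].

(** No element of the closure augments A, so A is a basis of it; an element outside
augments A, which raises the rank. *)
Lemma flat_indep_closure A : indep M A -> flat M (indep_closure A).
Proof.
move=> iA; apply/forall_inP => x; rewrite inE negb_or negbK => /andP[xA ixA].
have sA : A \subset indep_closure A by apply/subsetP => a aA; rewrite inE aA.
have [I [sI iI <-]] := mrank_indep (indep_closure A).
have leIA : (#|I| <= #|A|)%N.
  rewrite leqNgt; apply/negP => /(indep_aug iA iI)[y].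
  rewrite inE => /andP[yA /(subsetP sI)].
  by rewrite inE (negPf yA) /dependent => /negPf ->.
apply: (@leq_trans #|x |: A|); first by rewrite cardsU1 xA.
by apply: indep_card_mrank => //; apply: setUS.
Qed.

Lemma indep_closureS A B : A \subset B -> indep_closure A \subset indep_closure B.
Proof.
move=> AB; apply/subsetP => x; rewrite !inE => /orP[/(subsetP AB) -> //|dA].
by apply/orP; right; apply: contra dA; apply: indepS; apply: setUS.
Qed.

End Matroid.

(** * Generated ideals *)

Lemma in_mem_set (T : Type) (A : set T) x : x \in mem A <-> A x.
Proof. by split => /asboolP. Qed.

Section IdealGenerated.
Variables (S : nzRingType) (G : set S).

Lemma mem_ideal_generated x : G x -> ideal_generated G x.
Proof. exact: sub_gen_smallest. Qed.

Lemma ideal_generated0 : ideal_generated G 0.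
Proof. by move=> A [[[A0 _] _] _]; apply/in_mem_set. Qed.

Lemma ideal_generatedB x y :
  ideal_generated G x -> ideal_generated G y -> ideal_generated G (x - y).
Proof.
move=> xI yI A /[dup] PA [[[_ AB] _] _].
by apply/in_mem_set/AB; apply/in_mem_set; [apply: xI|apply: yI].
Qed.

Lemma ideal_generatedMl a x : ideal_generated G x -> ideal_generated G (a * x).
Proof. by move=> xI A /[dup] PA [[_ AM] _]; apply: (AM a x _).1; apply: xI. Qed.

End IdealGenerated.

(** * The ideal annihilates the tropical homology *)

Section FanPairing.
Variables (R : realType) (m : nat) (M : matroid 'I_m).
Implicit Types (s : seq {set 'I_m}) (x y z w v : exterior m) (a b : 'I_m).

Definition inseparable s a b := forall J, J \in s -> (a \in J) = (b \in J).

Lemma flat_vecE (J : {set 'I_m}) c : flat_vec J 0 c = (c \in J)%:R.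
Proof.
rewrite /flat_vec summxE; under eq_bigr do rewrite mxE eqxx /=.
rewrite big_mkcond (bigD1 c) //= eqxx big1 ?addr0; first by case: (c \in J).
by move=> j /negPf; rewrite eq_sym => ->; rewrite if_same.
Qed.

Lemma lattice_span_flat_vec s J : J \in s ->
  lattice_span (cone [seq real_vec R (flat_vec J) | J <- s]) (flat_vec J).
Proof.
move=> Js; apply: sub_gen_smallest.
have ltJ : (index J s < size [seq real_vec R (flat_vec J) | J <- s])%N.
  by rewrite size_map index_mem.
exists (fun i => (i == Ordinal ltJ)%:R) => [i|]; first exact: ler0n.
rewrite (bigD1 (Ordinal ltJ)) //= eqxx scale1r big1 ?addr0; last first.
  by move=> i /negPf ->; rewrite scale0r.
by rewrite (nth_map finset.set0) ?index_mem // nth_index.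
Qed.

(** Equality of two coordinates is a linear condition, and each generator of the cone
is the indicator vector of a member of s, which satisfies it. *)
Lemma lattice_span_inseparable s a b (u : 'rV[int]_m) : inseparable s a b ->
  lattice_span (cone [seq real_vec R (flat_vec J) | J <- s]) u -> u 0 a = u 0 b.
Proof.
move=> ab us; apply: (@intr_inj R).
suff : [set y : 'rV[R]_m | y 0 a = y 0 b]%classic (real_vec R u) by rewrite /= !mxE.
apply: us; split => [|y [c _ ->]]; last first.
  rewrite /= !summxE; apply: eq_bigr => i _; rewrite [LHS]mxE [RHS]mxE; congr (_ * _).
  have : (i < size s)%N by rewrite -(size_map (fun J => real_vec R (flat_vec J)) s).
  by move=> lt_i; rewrite (nth_map finset.set0) // !mxE !flat_vecE ab // mem_nth.
split => [|t y z]; first by apply/in_mem_set; rewrite /= !mxE.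
move=> /in_mem_set /= yab /in_mem_set /= zab; apply/in_mem_set.
by rewrite /= !mxE yab zab.
Qed.

(** By adjunction, these are the elements orthogonal to all multiples of the
differences f_a - f_b with a and b inseparable. *)
Definition block_forms s : set (exterior m) :=
  [set v | forall a b, inseparable s a b -> contraction a v = contraction b v]%classic.

Lemma block_forms_contraction s i v : block_forms s v -> block_forms s (contraction i v).
Proof.
by move=> vP a b ab; rewrite contraction_anticomm (vP _ _ ab) -contraction_anticomm.
Qed.

Lemma block_forms_prod s (l : seq 'rV[int]_m) :
  (forall u, u \in l -> forall a b, inseparable s a b -> u 0 a = u 0 b) ->
  block_forms s (\prod_(u <- l) ext_vec u).
Proof.
elim: l => [|u l IH] ul a b ab; first by rewrite big_nil !contraction1.
rewrite big_cons !contraction_vecM (ul u (mem_head _ _) a b ab).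
by rewrite (IH _ a b ab) // => u' u'l; apply: ul; rewrite inE u'l orbT.
Qed.

(** Quantifying over z makes stability under right multiplication immediate; left
multiplication by f_i is traded for a contraction of v. *)
Definition block_annihilator s : set (exterior m) :=
  [set w | forall z v, block_forms s v -> ext_pairing (w * z) v = 0]%classic.

Lemma block_annihilator_ideal s :
  GRing.zmod_closed (mem (block_annihilator s)) /\
  forall y x, block_annihilator s x ->
    block_annihilator s (y * x) /\ block_annihilator s (x * y).
Proof.
split; first split => [|x y /in_mem_set xX /in_mem_set yX]; first apply/in_mem_set.
- by move=> z v _; rewrite mul0r ext_pairing0l.
- apply/in_mem_set => z v vP.
  by rewrite mulrBl ext_pairingBl xX // yX // subr0.
move=> y x xX; split; last by move=> z v vP; rewrite -mulrA xX.
move: y; apply: ext_ind => [|a b aX bX|a aX||i a aX] z v vP.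
- by rewrite !mul0r ext_pairing0l.
- by rewrite !mulrDl ext_pairingDl aX // bX // addr0.
- by rewrite !mulNr ext_pairingNl aX // oppr0.
- by rewrite mul1r xX.
- by rewrite -!mulrA ext_pairing_genM mulrA aX //; apply: block_forms_contraction.
Qed.

(** Two inseparable elements a and b of S give F_S = +- f_a f_b y, and then
boundary F_S = +- (f_b - f_a) (y - f_b (boundary y)). *)
Lemma os_generator_block_annihilator s (S : {set 'I_m}) : loopless M -> flag M s ->
  dependent M S -> block_annihilator s (boundary (ext_basis S)).
Proof.
move=> nl /andP[srt fls] dS.
have {fls} fls : all (flat M) s by apply: sub_all fls => J /andP[].
have [a [b [aS bS nab ab]]] :
    exists a b, [/\ a \in S, b \in S, a != b & inseparable s a b].
  apply: contrapT => nex; move/negP: dS; apply.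
  apply: (flag_separated_indep nl srt fls) => a b aS bS ab.
  by apply/eqP/negPn/negP => nab; apply: nex; exists a, b.
set y : exterior m := ext_basis (S :\ a :\ b).
have bSa : b \in S :\ a by rewrite !inE eq_sym nab.
have [p ->] : exists p, ext_basis S = (-1) ^+ p * (ext_gen a * (ext_gen b * y)).
  exists (ninv [set b] (S :\ a :\ b) + ninv [set a] (S :\ a))%N.
  rewrite [ext_gen b * y]ext_basisM disjoints1 !inE eqxx /= setD1K //.
  rewrite mulr_signCA [ext_gen a * _]ext_basisM disjoints1 !inE eqxx /= setD1K //.
  by rewrite !mulrA -!exprD -signr_odd !oddD; do 2 case: (odd _); rewrite mul1r.
have -> : boundary ((-1) ^+ p * (ext_gen a * (ext_gen b * y))) =
    (-1) ^+ p * ((ext_gen b - ext_gen a) * (y - ext_gen b * boundary y)).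
  rewrite boundary_sign !boundary_genM; congr (_ * _).
  rewrite mulrBl !mulrBr [ext_gen b * (ext_gen b * _)]mulrA ext_gen_sqr.
  by rewrite mul0r subr0.
apply: ((block_annihilator_ideal s).2 _ _ _).1 => z v vP.
rewrite -mulrA mulrBl ext_pairingBl !ext_pairing_genM.
by rewrite (vP _ _ ab) subrr.
Qed.

Lemma os_ideal_pairing0 k w v : loopless M -> orlik_solomon_ideal M w ->
  tropical_homology k (matroid_fan R M) v -> ext_pairing w v = 0.
Proof.
move=> nl wI.
apply: (smallest_sub (X := [set v | ext_pairing w v = 0]%classic)) => [|v'] //.
  split; first by apply/in_mem_set; rewrite /= ext_pairingC ext_pairing0l.
  move=> x y /in_mem_set /= xw /in_mem_set /= yw; apply/in_mem_set.
  by rewrite /= ext_pairingC ext_pairingBl ![ext_pairing _ w]ext_pairingC xw yw subr0.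
move=> [_ [s fls <-] [u uspan ->]] /=.
suff wX : block_annihilator s w.
  rewrite -[w]mulr1; apply: wX; rewrite -(big_map u xpredT (@ext_vec m)).
  apply: block_forms_prod => _ /mapP[i _ ->] a b ab.
  exact: lattice_span_inseparable ab (uspan i).
apply: wI; split; first exact: block_annihilator_ideal.
by move=> _ [S dS <-]; apply: os_generator_block_annihilator.
Qed.

End FanPairing.

(** * Monomials without broken circuits *)

Section BrokenCircuits.
Variables (m : nat) (M : matroid 'I_m).
Implicit Types (A B K : {set 'I_m}) (x y z w v : exterior m) (c i : 'I_m).

Definition above c B := [set b in B | c < b]%N.

(** A broken circuit is a circuit with its least element c removed.  The set B is
dependent or contains a broken circuit exactly when c |: above c B is dependent
for some c, which is in B if the whole circuit is. *)
Definition nbc B := [forall c, indep M (c |: above c B)].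

Definition nbc_supported k y :=
  forall K, ext_coord y K != 0 -> nbc K /\ #|K| = k.

Definition nbc_reducible k x :=
  exists2 y, nbc_supported k y & orlik_solomon_ideal M (x - y).

Lemma nbc_reducible0 k : nbc_reducible k 0.
Proof.
exists 0; last by rewrite subr0; apply: ideal_generated0.
by move=> K; rewrite ext_coord0 eqxx.
Qed.

Lemma nbc_reducibleB k x x' :
  nbc_reducible k x -> nbc_reducible k x' -> nbc_reducible k (x - x').
Proof.
move=> [y yn xy] [y' yn' xy']; exists (y - y'); last first.
  by rewrite opprD addrACA -opprD; apply: ideal_generatedB.
move=> K; rewrite ext_coordD ext_coordN; have [->|/yn //] := eqVneq (ext_coord y K) 0.
by rewrite sub0r oppr_eq0 => /yn'.
Qed.

Lemma nbc_reducibleN k x : nbc_reducible k x -> nbc_reducible k (- x).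
Proof.
by move=> xr; rewrite -sub0r; apply: nbc_reducibleB => //; apply: nbc_reducible0.
Qed.

Lemma nbc_reducibleD k x y :
  nbc_reducible k x -> nbc_reducible k y -> nbc_reducible k (x + y).
Proof. by move=> xr yr; rewrite -[y]opprK; apply/nbc_reducibleB/nbc_reducibleN. Qed.

Lemma nbc_reducible_sign k p x : nbc_reducible k x -> nbc_reducible k ((-1) ^+ p * x).
Proof.
move=> xr; rewrite -signr_odd; case: odd; rewrite ?mulN1r ?mul1r //.
exact: nbc_reducibleN.
Qed.

Lemma nbc_reducibleMz k x n : nbc_reducible k x -> nbc_reducible k (x *~ n).
Proof.
move=> xr; have nat_red p : nbc_reducible k (x *+ p).
  elim: p => [|p IH]; rewrite ?mulrS; [exact: nbc_reducible0|exact: nbc_reducibleD].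
case: n => p; first exact: nat_red.
by rewrite NegzE mulrNz -pmulrn; apply/nbc_reducibleN/nat_red.
Qed.

Lemma nbc_reducible_sum k (J : finType) (P : pred J) (F : J -> exterior m) :
  (forall j, P j -> nbc_reducible k (F j)) -> nbc_reducible k (\sum_(j | P j) F j).
Proof.
by move=> Fr; apply: big_ind => //; [exact: nbc_reducible0|exact: nbc_reducibleD].
Qed.

Lemma nbc_reducible_congr k x y :
  orlik_solomon_ideal M (x - y) -> nbc_reducible k y -> nbc_reducible k x.
Proof.
move=> xy [z zn yz]; exists z => //; rewrite -[x](subrK y) -addrA -[y - z]opprK.
apply: ideal_generatedB => //; rewrite -sub0r; apply: ideal_generatedB => //.
exact: ideal_generated0.
Qed.

(** Let H be the part of A above c, with c |: H dependent, and let L be the rest of A.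
The boundary of f_c F_H = F_(c |: H) is F_H - f_c (boundary F_H), so F_A = +- F_L F_H
is congruent to +- F_L f_c (boundary F_H), a combination of monomials of the
same degree and smaller weight. *)
Lemma nbc_reducible_basis A : nbc_reducible #|A| (ext_basis A).
Proof.
have [d] := ubnP (weight A); elim: d A => // d IH A ltAd.
have [nA|/forallPn[c dA]] := boolP (nbc A).
  exists (ext_basis A); last by rewrite subrr; apply: ideal_generated0.
  by move=> K; rewrite ext_coord_basis; have [->|] := eqVneq K A; rewrite ?eqxx.
set H := above c A in dA.
have HP b : b \in H -> (b \in A) /\ (c < b)%N by rewrite inE => /andP.
clearbody H; set L := A :\: H.
have HA : H \subset A by apply/subsetP => b /HP[].
have cH : c \notin H by apply/negP => /HP[_]; rewrite ltnn.
have gen_cH : ext_gen c * ext_basis H = ext_basis (c |: H).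
  rewrite ext_basisM disjoints1 cH /ninv big_set1 big1 ?mul1r // => b.
  by move=> /HP[_ /ltnW]; rewrite leqNgt => /negPf ->.
have dLH : [disjoint L & H] by rewrite disjoints_subset subsetDr.
have LHA : L :|: H = A by rewrite -[RHS](setID A H) (setIidPr HA) setUC.
have -> : ext_basis A = (-1) ^+ ninv L H * (ext_basis L * ext_basis H).
  by rewrite ext_basisM dLH LHA mulrA -expr2 sqrr_sign mul1r.
apply: nbc_reducible_sign.
apply: (@nbc_reducible_congr _ _ (ext_basis L * (ext_gen c * boundary (ext_basis H)))).
  rewrite -mulrBr -boundary_genM gen_cH; apply: ideal_generatedMl.
  by apply: mem_ideal_generated; exists (c |: H).
rewrite boundary_sum_contraction !mulr_sumr; apply: nbc_reducible_sum => i _.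
rewrite contraction_basis; case: ifP => [iH|_]; last first.
  by rewrite !mulr0; apply: nbc_reducible0.
rewrite !mulr_signCA; apply: nbc_reducible_sign.
have cHi : c \notin H :\ i by rewrite !inE (negPf cH) andbF.
rewrite [ext_gen c * _]ext_basisM disjoints1 cHi mulr_signCA.
apply: nbc_reducible_sign.
(* If c is in A, then c is in L and the product is zero.  Otherwise the term is
   the monomial of A with i exchanged for the smaller element c. *)
rewrite ext_basisM; case: ifP => [dL|_]; last exact: nbc_reducible0.
apply: nbc_reducible_sign.
have [iA icA] := HP i iH.
have -> : L :|: (c |: H :\ i) = c |: A :\ i.
  rewrite setUCA; congr (_ |: _); apply/setP=> b; rewrite !inE.
  have [->|_] := eqVneq b i; first by rewrite iH.
  by have [bH|] := boolP (b \in H); rewrite ?orbT ?orbF // (HP b bH).1.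
have cAi : c \notin A :\ i.
  rewrite inE negb_and; apply/orP; right; apply/negP => cA.
  by move/disjoint_setI0/setP/(_ c): dL; rewrite !inE cA cH eqxx.
have -> : #|A| = #|c |: A :\ i| by rewrite cardsU1 cAi [LHS](cardsD1 i) iA.
apply: IH; rewrite ltnS in ltAd; apply: leq_trans ltAd.
by rewrite /weight big_setU1 //= [X in (_ < X)%N](big_setD1 i) //= ltn_add2r.
Qed.

(** An element c < b of the closure would make c |: above c B dependent. *)
Lemma nbc_closure_ge B b c : nbc B ->
  c \in indep_closure M [set b' in B | (b <= b')%N] -> (b <= c)%N.
Proof.
move=> /forallP/(_ c) icB; apply: contraTT; rewrite -ltnNge => ltcb.
rewrite !inE leqNgt ltcb andbF /dependent negbK; apply: indepS icB; apply: setUS.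
by apply/subsetP => b'; rewrite !inE => /andP[-> /(leq_trans ltcb)].
Qed.

(** If b is the least element of B, then b |: above b B is B. *)
Lemma nbc_indep B : nbc B -> indep M B.
Proof.
move=> nB; have [->|[b0 b0B]] := set_0Vmem B; first exact: indep0.
case: (@arg_minnP _ b0 (mem B) (fun b => b) b0B) => b bB minb.
apply: indepS (forallP nB b); apply/subsetP => b' b'B; rewrite !inE b'B /=.
by have := minb b' b'B; rewrite leq_eqVlt (inj_eq val_inj) eq_sym.
Qed.

Definition nbc_flat B (b : 'I_m) := indep_closure M [set b' in B | (b <= b')%N].

(** The flats decrease as b grows, strictly because b is in its own flat whereas the
flat of a larger c has no element below c. *)
Lemma flag_nbc_flat B : nbc B -> flag M (rev [seq nbc_flat B b | b <- enum B]).
Proof.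
move=> nB; rewrite /flag all_rev all_map; apply/andP; split; last first.
  apply/allP => b; rewrite mem_enum /= => bB; apply/andP; split.
    by apply/set0Pn; exists b; rewrite !inE bB leqnn.
  apply/flat_indep_closure/(indepS _ (nbc_indep nB)).
  by apply/subsetP => b'; rewrite inE => /andP[].
rewrite rev_sorted sorted_map.
have enumB : all (mem B) (enum B) by apply/allP => b; rewrite mem_enum.
have := sorted_enum_ord B; rewrite sorted_map.
apply: (sub_in_sorted _ enumB) => b c bB cB /= ltbc; rewrite properE; apply/andP; split.
  apply: indep_closureS; apply/subsetP => b'; rewrite !inE => /andP[->].
  by apply: leq_trans; apply: ltnW.
apply/subsetPn; exists b; first by rewrite !inE bB leqnn.
by apply/negP => /(nbc_closure_ge nB); rewrite leqNgt ltbc.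
Qed.

(** Pair y with the product of the e_J over the flag attached to a B of maximal weight
in the support of y: only the leading term F_B of the product meets that
support. *)
Lemma nbc_supported_eq0 (R : realType) k y : nbc_supported k y ->
  (forall v, tropical_homology k (matroid_fan R M) v -> ext_pairing y v = 0) -> y = 0.
Proof.
move=> yn yperp; apply: ext_coordP => B0; rewrite ext_coord0.
apply/eqP/negPn/negP => yB0.
case: (@arg_maxnP _ B0 (fun K => ext_coord y K != 0) (@weight m) yB0) => B yB maxB.
have [nB cB] := yn B yB.
pose u b : 'rV[int]_m := flat_vec (nbc_flat B b).
have uE b c : u b 0 c = (c \in nbc_flat B b)%:R by exact: flat_vecE.
have [||_ lead] := @prod_vec_leading m (enum B) u.
- by move=> b; rewrite mem_enum uE !inE leqnn => ->.
- by move=> b c _; rewrite uE; case: (boolP (c \in _)) => // /(nbc_closure_ge nB).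
have wB : (\sum_(b <- enum B) b)%N = weight B by rewrite big_enum.
rewrite -ext_basisE wB in lead; set v := \prod_(b <- _) _ in lead.
have := yperp v; rewrite -[v](subrK (ext_basis B)) ext_pairingC ext_pairingDl.
rewrite ext_pairing_basisl.
rewrite [ext_pairing (v - _) y]big1 ?add0r; last first.
  move=> K _; have [->|/maxB leKB] := eqVneq (ext_coord y K) 0; first by rewrite mulr0.
  have [->|/lead] := eqVneq (ext_coord (v - ext_basis B) K) 0; first by rewrite mul0r.
  by rewrite ltnNge (leKB : (weight K <= weight B)%N).
rewrite subrK => yB0'; move/eqP: yB; apply; apply: yB0'.
apply: sub_gen_smallest; rewrite /v big_tnth -cB cardE.
exists (cone [seq real_vec R (flat_vec J) | J <- rev [seq nbc_flat B b | b <- enum B]]).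
  by exists (rev [seq nbc_flat B b | b <- enum B]) => //; apply: flag_nbc_flat.
exists (fun t : 'I_(size (enum B)) => u (tnth (in_tuple (enum B)) t)) => // t.
apply: lattice_span_flat_vec; rewrite mem_rev; apply: map_f; exact: mem_tnth.
Qed.

End BrokenCircuits.

Local Open Scope classical_set_scope.

Theorem theorem3 (R : realType) (N n : nat) (M : matroid 'I_N.+1)
    (hrank : mrank M [set: 'I_N.+1]%SET = n) (hM : loopless M) (k : nat) :
  ext_perp k (tropical_homology k (matroid_fan R M)) =
  orlik_solomon_ideal M `&` ext_degree k.
Proof.
apply/seteqP; split => w; last first.
  by move=> [wI wk]; split=> // v; apply: os_ideal_pairing0.
move=> [wk wperp]; split=> //.
have [y yn wyI] : nbc_reducible M k w.
  rewrite [w]ext_sum_basis; apply: nbc_reducible_sum => K _.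
  have [->|/wk <-] := eqVneq (ext_coord w K) 0.
    by rewrite mulr0z; apply: nbc_reducible0.
  exact/nbc_reducibleMz/nbc_reducible_basis.
suff y0 : y = 0 by rewrite y0 subr0 in wyI.
apply: (@nbc_supported_eq0 _ M R k) => // v vF.
rewrite -[y](subKr w) ext_pairingBl wperp //.
by rewrite (os_ideal_pairing0 hM wyI vF) subr0.
Qed.
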